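(* Let $I=(h_1,\ldots,h_m)$ be an ideal in $\mathbb{R}[\mathbf{x}]$, let $D=\max_j\deg(h_j)$, and let $s,t$ be integers with $1\le s\le t$. Let $\mathcal{G}\subseteq\mathbb{R}[\mathbf{x}]_t$ satisfy $h_1,\ldots,h_m\in\mathcal{G}$ and $\mathcal{G}\subseteq I$ (resp., $\mathcal{G}\subseteq\sqrt[\mathbb{R}]{I}$). (0) If $\dim\pi_s(\mathcal{G}^\perp)=0$, then $V_{\mathbb{C}}(I)=\emptyset$ (resp., $V_{\mathbb{R}}(I)=\emptyset$). Assume now that $\dim \pi_s(\mathcal{G}^\perp)\neq 0$, that $s\ge D$, and that $$\dim\pi_s(\mathcal{G}^\perp)=\dim\pi_{s-1}(\mathcal{G}^\perp)\quad\text{and}\quad \dim\pi_s(\mathcal{G}^\perp)=\dim\pi_s((\mathcal{G}^+)^\perp).$$ (1) There exists a set $\mathcal{B}\subseteq\mathbb{T}^n_{s-1}$ closed under taking divisions (and thus connected to 1) for which the following direct sum decomposition holds: $$\mathbb{R}[\mathbf{x}]_s=\mathrm{Span}_{\mathbb{R}}(\mathcal{B})\oplus\big(\mathbb{R}[\mathbf{x}]_s\cap\mathrm{Span}_{\mathbb{R}}(\mathcal{G})\big).\qquad( * )$$ (2) Let $\mathcal{B}\subseteq\mathbb{T}^n_{s-1}$ be any set connected to 1 for which $( * )$ holds, let $\varphi$ be the projection from $\mathbb{R}[\mathbf{x}]_s$ onto $\mathrm{Span}_{\mathbb{R}}(\mathcal{B})$ along $\mathbb{R}[\mathbf{x}]_s\cap\mathrm{Span}_{\mathbb{R}}(\mathcal{G})$,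 and let $F_0:=\{m-\varphi(m)\mid m\in\partial\mathcal{B}\}$ and $J:=(F_0)$. Then $\mathcal{B}$ is a basis of $\mathbb{R}[\mathbf{x}]/J$ and $F_0$ is a border basis of $J$. Moreover: (a) If $\mathcal{G}\subseteq I$, then $J=I$. (b) If $\mathcal{G}\subseteq\sqrt[\mathbb{R}]{I}$, then $$V_{\mathbb{R}}(I)=V_{\mathbb{C}}(J)\cap\mathbb{R}^n,\qquad J\cap\mathbb{R}[\mathbf{x}]_s=\mathrm{Span}_{\mathbb{R}}(\mathcal{G})\cap\mathbb{R}[\mathbf{x}]_s,\qquad \pi_s(\mathcal{D}[J])=\pi_s(\mathcal{G}^\perp),$$ and in addition $J=\sqrt[\mathbb{R}]{I}$ if $\dim\pi_s(\mathcal{G}^\perp)=|V_{\mathbb{R}}(I)|$.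
   Context: $\mathbb{R}[\mathbf{x}]=\mathbb{R}[x_1,\ldots,x_n]$, and $\mathbb{R}[\mathbf{x}]_t$ is the subspace of polynomials of degree at most $t$. $\mathbb{T}^n=\{\mathbf{x}^\alpha\mid\alpha\in\mathbb{N}^n\}$ is the set of monomials and $\mathbb{T}^n_t$ the set of monomials of degree at most $t$. For an ideal $I$, $V_{\mathbb{C}}(I)\subseteq\mathbb{C}^n$ is its set of common complex zeros, $V_{\mathbb{R}}(I)=V_{\mathbb{C}}(I)\cap\mathbb{R}^n$, and $\sqrt[\mathbb{R}]{I}=\{p\mid p^{2k}+\sum_j q_j^2\in I\text{ for some } q_j\in\mathbb{R}[\mathbf{x}],\ k\ge1\}$ (finite sum) is its real radical, which equals the ideal of polynomials in $\mathbb{R}[\mathbf{x}]$ vanishing on $V_{\mathbb{R}}(I)$. For a real vector space $A$ with dual $A^*$ and $B\subseteq A$, $B^\perp=\{L\in A^*\mid L(b)=0\ \forall b\in B\}$. For $S\subseteq\mathbb{R}[\mathbf{x}]$, $S^+:=S\cup x_1S\cup\cdots\cup x_nS$. For $\mathcal{G}\subseteq\mathbb{R}[\mathbf{x}]_t$, $\mathcal{G}^\perp$ is taken in $(\mathbb{R}[\mathbf{x}]_t)^*$ and $(\mathcal{G}^+)^\perp$ is taken in $(\mathbb{R}[\mathbf{x}]_{t+1})^*$. $\pi_s$ denotes restriction of linear functionals (from $(\mathbb{R}[\mathbf{x}])^*$, or from $(\mathbb{R}[\mathbf{x}]_{t'})^*$ with $t'\ge s$) to $\mathbb{R}[\mathbf{x}]_s$.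 For an ideal $J$, $\mathcal{D}[J]:=J^\perp\subseteq(\mathbb{R}[\mathbf{x}])^*$. For $\mathcal{B}\subseteq\mathbb{T}^n$, $\partial\mathcal{B}:=\mathcal{B}^+\setminus\mathcal{B}$. $\mathcal{B}$ is closed under taking divisions if $m\in\mathcal{B}$ and $m'\in\mathbb{T}^n$ divides $m$ imply $m'\in\mathcal{B}$. $\mathcal{B}$ is connected to 1 if each $m\in\mathcal{B}$ can be written as $m=m_1m_2\cdots m_k$ with $m_1=1$, $m_2,\ldots,m_k\in\{x_1,\ldots,x_n\}$ and $m_1\cdots m_h\in\mathcal{B}$ for all $h=1,\ldots,k$. ''$\mathcal{B}$ is a basis of $\mathbb{R}[\mathbf{x}]/J$'' means that the cosets of the elements of $\mathcal{B}$ are pairwise distinct and form a linear basis. A family $F_0=\{m-r_m\mid m\in\partial\mathcal{B}\}$ with all $r_m\in\mathrm{Span}_{\mathbb{R}}(\mathcal{B})$ is a border basis of an ideal $J$ (with respect to $\mathcal{B}$) if $F_0$ generates $J$ and $\mathcal{B}$ is a basis of $\mathbb{R}[\mathbf{x}]/J$. *)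

(* Defs.v *)
From HB Require Import structures.
From mathcomp Require Import all_boot all_order all_algebra.
From mathcomp Require Import boolp classical_sets cardinality reals.
From mathcomp Require Import complex mpoly.

Set Implicit Arguments.
Unset Strict Implicit.
Unset Printing Implicit Defensive.

Import GRing.Theory.

Local Open Scope classical_set_scope.
Local Open Scope ring_scope.

Section LinearAlgebra.
Variable F : fieldType.

Definition lspan (V : lmodType F) (S : set V) : set V :=
  [set v | exists (k : nat) (c : 'I_k -> F) (f : 'I_k -> V),
     (forall i, S (f i)) /\ v = \sum_(i < k) c i *: f i].

Definition direct_sum (V : lmodType F) (A U W : set V) : Prop :=
  A = [set v | exists u w, [/\ U u, W w & v = u + w]] /\ U `&` W = [set 0].

(* Only the values of phi on U + W are constrained. *)
Definition projection_onto_along (V : lmodType F) (U W : set V)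
    (phi : V -> V) : Prop :=
  forall u w, U u -> W w -> phi (u + w) = u.

(* Maximal number of linearly independent vectors of S; it is the dimension
   of S when S is a subspace, see setdim_vspace. *)
Definition setdim (V : vectType F) (S : set V) : nat :=
  \max_(k < (dim V).+1 |
        `[< exists X : k.-tuple V, free X /\ {in X, forall x, S x} >]) k.

Lemma setdim_vspace (V : vectType F) (U : {vspace V}) :
  setdim [set v | v \in U] = (\dim U)%N.
Proof.
apply/eqP; rewrite eqn_leq; apply/andP; split.
  apply/bigmax_leqP => k /asboolP [X [/eqP fX XU]].
  rewrite -[leqLHS](size_tuple X) -fX; apply: dimvS.
  by apply/span_subvP => x /XU.
have dU : (\dim U < (dim V).+1)%N by rewrite ltnS -dimvf dimvS ?subvf.
rewrite /setdim (bigmax_sup (Ordinal dU)) //.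
apply/asboolP; exists (vbasis U); split; first exact: basis_free (vbasisP U).
by move=> x xU; exact: vbasis_mem xU.
Qed.

End LinearAlgebra.

Section BoundedDegree.
Variables (n : nat) (R : nzRingType) (t : nat).

(* msize p is one plus the degree of p, and msize 0 = 0. *)
Definition mpoly_deg_le : pred {mpoly R[n]} := fun p => (msize p <= t.+1)%N.

Fact mpoly_deg_le_submod_closed : submod_closed mpoly_deg_le.
Proof.
split=> [|c p q]; rewrite /in_mem /= /mpoly_deg_le ?msize0 // => hp hq.
apply: leq_trans (msizeD_le _ _) _; rewrite geq_max hq andbT.
exact: leq_trans (msizeZ_le _ _) hp.
Qed.

HB.instance Definition _ :=
  GRing.isSubmodClosed.Build R {mpoly R[n]} mpoly_deg_le
    mpoly_deg_le_submod_closed.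

Record bpoly := BPoly { bpoly_val : {mpoly R[n]}; _ : mpoly_deg_le bpoly_val }.

HB.instance Definition _ := [isSub for bpoly_val].
HB.instance Definition _ := [Choice of bpoly by <:].
HB.instance Definition _ := [SubChoice_isSubLmodule of bpoly by <:].

Local Notation N := #|{: 'X_{1..n < t.+1}}|.

Fact bpoly_vector_axiom : vector_axiom N bpoly.
Proof.
pose f (p : bpoly) : 'rV[R]_N := \row_i (val p)@_(val (enum_val i)).
pose g0 (v : 'rV[R]_N) : {mpoly R[n]} :=
  \sum_(i < N) v 0 i *: 'X_[val (enum_val i)].
have g0P v : mpoly_deg_le (g0 v).
  rewrite /mpoly_deg_le; apply: leq_trans (msize_sum _ _ _) _.
  apply/bigmax_leqP => i _; apply: leq_trans (msizeZ_le _ _) _.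
  by rewrite msizeX bmdeg.
pose g v := BPoly (g0P v).
have g0E v i : (g0 v)@_(val (enum_val i)) = v 0 i.
  rewrite /g0 raddf_sum /= (bigD1 i) //= mcoeffZ mcoeffX eqxx mulr1.
  rewrite big1 ?addr0 // => j ne_ji; rewrite mcoeffZ mcoeffX.
  by rewrite (inj_eq val_inj) (inj_eq enum_val_inj) (negbTE ne_ji) mulr0.
exists f; first by move=> c p q; apply/rowP=> i; rewrite !mxE /= mcoeffD mcoeffZ.
exists g => [p|v]; last by apply/rowP=> i; rewrite mxE g0E.
apply/val_inj/mpolyP => m /=; case: (ltnP (mdeg m) t.+1) => hm.
  by rewrite -[m]/(val (BMultinom hm)) -[BMultinom hm]enum_rankK g0E mxE.
rewrite !memN_msupp_eq0 //; apply/negP => /msize_mdeg_lt.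
- by rewrite ltnNge (leq_trans _ hm) //; case: p.
- by rewrite ltnNge (leq_trans _ hm) //; exact: g0P.
Qed.

HB.instance Definition _ :=
  Lmodule_hasFinDim.Build R bpoly bpoly_vector_axiom.

End BoundedDegree.

Section Functionals.
Variables (R : realType) (n : nat).

Definition dual (t : nat) := 'Hom(bpoly n R t, R^o).

Definition perp (t : nat) (G : set {mpoly R[n]}) : set (dual t) :=
  [set L : dual t | forall p : bpoly n R t, G (val p) -> L p = 0].

(* Restrictions to degree <= s of the functionals in A; meant for s <= t. *)
Definition restr (t s : nat) (A : set (dual t)) : set (dual s) :=
  [set M : dual s | exists2 L : dual t, A L &
     forall (p : bpoly n R s) (q : bpoly n R t), val p = val q -> M p = L q].

Definition full_perp (J : set {mpoly R[n]}) :
    set {linear {mpoly R[n]} -> R^o} :=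
  [set L : {linear {mpoly R[n]} -> R^o} | forall p, J p -> L p = 0].

Definition full_restr (s : nat) (A : set {linear {mpoly R[n]} -> R^o}) :
    set (dual s) :=
  [set M : dual s | exists2 L : {linear {mpoly R[n]} -> R^o}, A L &
     forall p : bpoly n R s, M p = L (val p)].

Definition prolong (S : set {mpoly R[n]}) : set {mpoly R[n]} :=
  S `|` [set p | exists i q, S q /\ p = 'X_i * q].

End Functionals.

Arguments perp {R n} t G.
Arguments restr {R n t} s A.
Arguments full_restr {R n} s A.

Section IdealsVarieties.
Variables (R : realType) (n : nat).
Implicit Types I : set {mpoly R[n]}.

Definition ideal_gen (S : set {mpoly R[n]}) : set {mpoly R[n]} :=
  [set p | exists (k : nat) (q f : 'I_k -> {mpoly R[n]}),
     (forall i, S (f i)) /\ p = \sum_(i < k) q i * f i].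

Definition real_radical I : set {mpoly R[n]} :=
  [set p | exists (k : nat) (q : seq {mpoly R[n]}),
     (1 <= k)%N /\ I (p ^+ (2 * k) + \sum_(f <- q) f ^+ 2)].

Definition VC I : set 'rV[R[i]]_n :=
  [set z : 'rV[R[i]]_n | forall p, I p ->
     (map_mpoly (real_complex R) p).@[z ord0] = 0].

(* The real points of VC I, as points of R^n. *)
Definition VR I : set 'rV[R]_n :=
  [set v : 'rV[R]_n | VC I (map_mx (real_complex R) v)].

End IdealsVarieties.

(* Monomials are represented by their exponents: the product of monomials is
   the sum in 'X_{1..n}, and divisibility is the pointwise order. *)
Section Monomials.
Variable n : nat.
Implicit Types B : set 'X_{1..n}.

Definition border B : set 'X_{1..n} :=
  (B `|` [set m | exists i m', B m' /\ m = (U_(i) + m')%MM]) `\` B.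

Definition division_closed B : Prop :=
  forall m m' : 'X_{1..n}, B m -> (m' <= m)%MM -> B m'.

(* The partial products 1, x_{w_1}, x_{w_1} x_{w_2}, ... all lie in B. *)
Definition connected_to_1 B : Prop :=
  forall m : 'X_{1..n}, B m -> exists w : seq 'I_n,
    m = (\sum_(i <- w) U_(i))%MM /\
    forall h, (h <= size w)%N -> B (\sum_(i <- take h w) U_(i))%MM.

Variable R : realType.
Implicit Types F J : set {mpoly R[n]}.

Definition mono_span B : set {mpoly R[n]} :=
  lspan [set 'X_[m] | m in B].

(* Linear independence of the family of cosets indexed by B, which subsumes
   their being pairwise distinct, together with spanning. *)
Definition quotient_basis B J : Prop :=
  (forall (ms : seq 'X_{1..n}) (c : 'X_{1..n} -> R),
     uniq ms -> {in ms, forall m, B m} ->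
     J (\sum_(m <- ms) c m *: 'X_[m]) -> {in ms, forall m, c m = 0}) /\
  (forall p : {mpoly R[n]}, exists2 q, mono_span B q & J (p - q)).

Definition border_basis B F J : Prop :=
  [/\ exists r : 'X_{1..n} -> {mpoly R[n]},
        (forall m, border B m -> mono_span B (r m)) /\
        F = [set 'X_[m] - r m | m in border B],
      J = ideal_gen F
    & quotient_basis B J].

End Monomials.

(* Main.v *)
Require Import Defs.
From HB Require Import structures.
From mathcomp Require Import all_boot all_order all_algebra.
From mathcomp Require Import boolp classical_sets cardinality reals.
From mathcomp Require Import complex mpoly ssrcomplements.
From mathcomp Require Import ring.

(* Put W = R[x]_s \cap Span(G).  The space pi_s(G^perp) is the annihilator of W,
   so the two rank conditions say that R[x]_s = R[x]_(s-1) + W and that W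
   contains every polynomial of degree at most s in Span(G^+).

   The monomials of degree at most s that are not leading monomials of W, for a
   graded monomial order, form the set B of (1): leading monomials of W are
   stable under multiplication by a variable up to degree s, and every monomial
   of degree s is one.

   Given any B as in (2), the operators u |-> phi(x_i u) on Span(B) commute,
   since x_i phi(x_j u) - x_j phi(x_i u) lies in W.  Letting polynomials act on
   1 through them yields a linear normal form that coincides with phi on R[x]_s
   and is congruent to the identity modulo J; its kernel is exactly J, hence J
   meets R[x]_s in W.  When |V_R(I)| = dim pi_s(G^perp) = |B|, a normal form
   vanishing on V_R(I) is zero by interpolation, so J contains the real radical
   of I; the latter is an ideal containing G, hence J. *)

Set Implicit Arguments.
Unset Strict Implicit.
Unset Printing Implicit Defensive.

Import GRing.Theory.

Local Open Scope classical_set_scope.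
Local Open Scope ring_scope.

(** * Linear spans, finite-dimensional subspaces and annihilators *)

Section Submodules.
Variables (F : fieldType) (V : lmodType F).
Implicit Types S T A U W : set V.

Definition is_submodule T :=
  T 0 /\ forall a u v, T u -> T v -> T (a *: u + v).

Section Closure.
Variables (T : set V) (subT : is_submodule T).

Lemma submodule0 : T 0. Proof. by case: subT. Qed.

Lemma submoduleZ a u : T u -> T (a *: u).
Proof. by move=> Tu; rewrite -[_ *: _]addr0; apply: subT.2 => //; exact: submodule0. Qed.

Lemma submoduleD u v : T u -> T v -> T (u + v).
Proof. by move=> Tu Tv; rewrite -[u]scale1r; exact: subT.2. Qed.

Lemma submoduleB u v : T u -> T v -> T (u - v).
Proof. by move=> Tu Tv; rewrite addrC -scaleN1r; exact: subT.2. Qed.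

Lemma submodule_sum (I : Type) (r : seq I) (P : pred I) (f : I -> V) :
  (forall i, P i -> T (f i)) -> T (\sum_(i <- r | P i) f i).
Proof.
by move=> Tf; elim/big_rec: _ => [|i v Pi Tv];
  [exact: submodule0 | exact/submoduleD/Tv/Tf].
Qed.

End Closure.

Lemma is_submoduleI S T : is_submodule S -> is_submodule T -> is_submodule (S `&` T).
Proof.
move=> [S0 SD] [T0 TD]; split=> // a u v [Su Tu] [Sv Tv].
by split; [exact: SD | exact: TD].
Qed.

Lemma sub_lspan S : S `<=` lspan S.
Proof.
move=> v Sv; exists 1%N, (fun=> 1), (fun=> v); split=> //.
by rewrite big_ord_recl big_ord0 addr0 scale1r.
Qed.

Lemma lspan_submodule S : is_submodule (lspan S).
Proof.
split; first by exists 0%N, (fun=> 0), (fun=> 0); split; [case | rewrite big_ord0].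
move=> a u v [k [c [f [Sf ->]]]] [l [d [g [Sg ->]]]].
exists (k + l)%N, (fun i => match fintype.split i with inl i => a * c i | inr i => d i end),
  (fun i => match fintype.split i with inl i => f i | inr i => g i end).
split; first by move=> i; case: (fintype.split i).
rewrite big_split_ord /= scaler_sumr; congr (_ + _); apply: eq_bigr => i _.
  by rewrite -[lshift l i]/(unsplit (inl i)) unsplitK scalerA.
by rewrite -[rshift k i]/(unsplit (inr i)) unsplitK.
Qed.

Lemma lspan_min S T : is_submodule T -> S `<=` T -> lspan S `<=` T.
Proof.
move=> subT ST v [k [c [f [Sf ->]]]].
by apply: submodule_sum => // i _; apply: submoduleZ => //; exact/ST/Sf.
Qed.

Lemma lspan_mono S T : S `<=` T -> lspan S `<=` lspan T.
Proof.
by move=> ST; apply: lspan_min; [exact: lspan_submodule | move=> v /ST /sub_lspan].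
Qed.

Lemma direct_sum_ex A U W v :
  direct_sum A U W -> A v -> exists2 u : V, U u & W (v - u).
Proof.
by move=> [-> _] [u [w [Uu Ww ->]]]; exists u => //; rewrite addrC addKr.
Qed.

Lemma direct_sum_subl A U W : direct_sum A U W -> W 0 -> U `<=` A.
Proof. by move=> [-> _] W0 u Uu; exists u, 0; rewrite addr0. Qed.

Lemma direct_sum0 A U W (v : V) : direct_sum A U W -> U v -> W v -> v = 0.
Proof.
move=> [_ capE] Uv Wv.
by have : (U `&` W) v by []; rewrite capE.
Qed.

End Submodules.

Lemma setdim_eq (F : fieldType) (V : vectType F) (T : set V) (U : {vspace V}) :
  (forall v, T v <-> v \in U) -> setdim T = (\dim U)%N.
Proof.
move=> TU; rewrite -setdim_vspace; congr setdim.
by apply: funext => v; apply: propext; exact: TU.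
Qed.

Section FiniteDimension.
Variables (F : fieldType) (V : vectType F).

(** A subspace of maximal dimension inside [T] already absorbs the line through any vector of [T].
    This lets dimensions be counted for set-level spans. *)
Lemma submodule_vspaceP (T : set V) :
  is_submodule T -> exists U : {vspace V}, forall v, (v \in U) <-> T v.
Proof.
move=> subT.
pose P d := `[< exists U : {vspace V}, \dim U = d /\ {in U, forall v, T v} >].
have exP : exists d, P d.
  exists 0%N; apply/asboolP; exists 0%VS; split; first exact: dimv0.
  by move=> v; rewrite memv0 => /eqP ->; exact: submodule0 subT.
have leP d : P d -> (d <= dim V)%N.
  by move=> /asboolP [U [<- _]]; rewrite -dimvf dimvS ?subvf.
case: (ex_maxnP exP leP) => d /asboolP [U [dU UT]] maxd.
exists U => v; split=> [/UT //|Tv].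
have: (\dim (U + <[v]>)%VS <= \dim U)%N.
  rewrite dU; apply: maxd; apply/asboolP; exists (U + <[v]>)%VS; split=> //.
  move=> _ /memv_addP [u Uu [_ /vlineP [c ->] ->]].
  by apply: submoduleD => //; [exact: UT | exact: submoduleZ].
rewrite (geq_leqif (dimv_leqif_sup (addvSl _ _))) => /subvP; apply.
by apply: (subvP (addvSr _ _)); exact: memv_line.
Qed.

(** Rank-nullity for the restriction of functionals to [U]: the kernel is the annihilator, and
    composing with [vsproj U] extends any functional on [U], so restriction is onto. *)
Lemma setdim_annihilator (U : {vspace V}) :
  setdim [set L : 'Hom(V, F^o) | {in U, forall v, L v = 0}] = (dim V - \dim U)%N.
Proof.
pose rst (L : 'Hom(V, F^o)) := (L \o linfun (@vsval F V U))%VF.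
have rst_lin : linear rst.
  by move=> a L M; rewrite /rst comp_lfunDl comp_lfunZl.
pose rstL : {linear _ -> _} := HB.pack rst (GRing.isLinear.Build _ _ _ _ _ rst_lin).
pose f := linfun rstL.
have ->: setdim [set L : 'Hom(V, F^o) | {in U, forall v, L v = 0}] = (\dim (lker f))%N.
  apply: setdim_eq => L; rewrite memv_ker lfunE /=; split=> [L0|/eqP L0 v Uv].
    by apply/eqP/lfunP => v; rewrite comp_lfunE !lfunE /= L0 // subvsP.
  have := congr1 (fun M : 'Hom(_, _) => M (vsproj U v)) L0.
  by rewrite /rst comp_lfunE !lfunE /= vsprojK.
have imf : (limg f = fullv)%VS.
  apply/eqP; rewrite eqEsubv subvf /=; apply/subvP => M _.
  apply/memv_imgP; exists (M \o linfun (vsproj U))%VF; rewrite ?memvf // lfunE /=.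
  by apply/lfunP => v; rewrite !comp_lfunE !lfunE /= vsvalK.
have := limg_ker_dim f fullv; rewrite imf capfv !dimvf.
(* The dimension of a Hom space is by definition a product, here with second factor 1. *)
have -> : dim 'Hom(V, F^o) = dim V by exact: muln1.
have -> : dim 'Hom(subvs_of U, F^o) = \dim U by exact: muln1.
by move=> <-; rewrite addnK.
Qed.

End FiniteDimension.

(** * Annihilators of truncated spans *)

Notation deg_le s := [set p | mpoly_deg_le s p].

Section TruncatedSpans.
Variables (R : realType) (n : nat).
Implicit Types (G : set {mpoly R[n]}) (s t : nat) (p q : {mpoly R[n]}).

Lemma mpoly_deg_le_submodule s : is_submodule (deg_le s : set {mpoly R[n]}).
Proof.
have [_ lin] := @mpoly_deg_le_submod_closed n R s.
by split=> [|a u v]; [rewrite /= /mpoly_deg_le msize0 | exact: lin].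
Qed.

Lemma mpoly_deg_le_trans s t p : (s <= t)%N -> mpoly_deg_le s p -> mpoly_deg_le t p.
Proof. by rewrite /mpoly_deg_le => st ps; apply: leq_trans ps _. Qed.

Lemma bpoly_submodule s (T : set {mpoly R[n]}) :
  is_submodule T -> is_submodule [set p : bpoly n R s | T (val p)].
Proof. by case=> T0 TD; split=> //= a u v Tu Tv; exact: TD. Qed.

Section Widening.
Variables (s t : nat) (le_st : (s <= t)%N).

Fact widen_subproof (p : bpoly n R s) : mpoly_deg_le t (val p).
Proof. by apply: mpoly_deg_le_trans le_st _; case: p. Qed.

Definition widen (p : bpoly n R s) := BPoly (widen_subproof p).

Fact widen_linear : linear widen.
Proof. by move=> a p q; exact: val_inj. Qed.

HB.instance Definition _ := GRing.isLinear.Build _ _ _ _ widen widen_linear.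

Lemma lker_widen : lker (linfun widen) = 0%VS.
Proof. by apply/eqP/lker0P => p q; rewrite !lfunE => -[] /val_inj. Qed.

(** The point is extension: a functional killing the part of Span(G) of degree at most s is well
    defined on R[x]_s + Span(G) when set to zero on Span(G). *)
Lemma restr_perpE G : G `<=` deg_le t ->
  restr s (perp t G) =
  [set M : dual R n s | forall p : bpoly n R s, lspan G (val p) -> M p = 0].
Proof.
move=> Gt; apply/seteqP; split=> M.
  move=> [L LG ML] p [k [c [f [Gf pE]]]].
  pose g i : bpoly n R t := BPoly (Gt _ (Gf i)).
  rewrite (ML p (\sum_(i < k) c i *: g i)).
    rewrite linear_sum big1 // => i _; rewrite linearZ /=.
    by have -> := LG (g i) (Gf i); exact: scaler0.
  by rewrite pE linear_sum; apply: eq_bigr => i _; rewrite linearZ.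
move=> M0.
have [W WE] := submodule_vspaceP (bpoly_submodule t (lspan_submodule G)).
pose iota := linfun widen.
(* [addv_pi1] projects along all of [W], so [L] kills [W] even where it overlaps the image of
   [iota]. *)
pose L : dual R n t := (M \o (iota^-1 \o addv_pi1 (limg iota) W))%VF.
exists L => [q Gq|p q pq].
  have Wq : q \in W by apply/WE; exact: sub_lspan.
  have := @addv_pi1_pi2 _ _ (limg iota) W q.
  rewrite addv_pi2_id // => /(_ (subvP (addvSr _ _) _ Wq)).
  move=> /(canRL (addrK _)); rewrite subrr => pi0.
  by rewrite !comp_lfunE pi0 !linear0.
have -> : q = iota p by rewrite lfunE; apply/val_inj.
have Xp : iota p \in limg iota by rewrite memv_img ?memvf.
have := @addv_pi1_pi2 _ _ (limg iota) W (iota p).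
move=> /(_ (subvP (addvSl _ _) _ Xp)).
set a := addv_pi1 _ _ _; set b := addv_pi2 _ _ _ => ab.
have [a' _ aE] : exists2 a', a' \in fullv & a = iota a'.
  apply/memv_imgP; exact: memv_pi1.
have bE : val b = val (p - a').
  have -> : b = iota p - a by rewrite -ab addrC addKr.
  by rewrite aE !lfunE.
rewrite !comp_lfunE -/a aE lker0_lfunK ?lker_widen //.
(* The two sides differ by [M] at [p - a'], which is the component [b] in [W]. *)
apply/eqP; rewrite -subr_eq0 -linearB; apply/eqP/M0.
by rewrite -bE; apply/WE/memv_pi2.
Qed.

Lemma setdim_restr_perp G (U : {vspace bpoly n R s}) :
    G `<=` deg_le t ->
    (forall p : bpoly n R s, p \in U <-> lspan G (val p)) ->
  setdim (restr s (perp t G)) = (dim (bpoly n R s) - \dim U)%N.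
Proof.
move=> Gt UE; rewrite restr_perpE // -setdim_annihilator; congr setdim.
by apply/seteqP; split=> M M0 p /UE; exact: M0.
Qed.

End Widening.

Lemma restr_perp_dim0 G s t : (s <= t)%N ->
    G `<=` deg_le t -> setdim (restr s (perp t G)) = 0%N ->
  forall p, mpoly_deg_le s p -> lspan G p.
Proof.
move=> st Gt; have [U UE] := submodule_vspaceP (bpoly_submodule s (lspan_submodule G)).
rewrite (setdim_restr_perp st Gt UE) => /eqP; rewrite subn_eq0 -dimvf => dU p ps.
have /eqP fU : U == fullv by rewrite eqEdim subvf.
by apply/(UE (BPoly ps)); rewrite fU memvf.
Qed.

(** With U and U' the parts of Span(G) of degree at most s and s', U meets R[x]_s' exactly in U'.
    Equal codimensions then give dim(R[x]_s' + U) = dim R[x]_s. *)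
Lemma restr_perp_dim_prev G s s' t : (s' <= s)%N -> (s <= t)%N ->
    G `<=` deg_le t -> setdim (restr s (perp t G)) = setdim (restr s' (perp t G)) ->
  forall p, mpoly_deg_le s p -> exists2 q, mpoly_deg_le s' q & lspan G (p - q).
Proof.
move=> s's st Gt.
have [U UE] := submodule_vspaceP (bpoly_submodule s (lspan_submodule G)).
have [U' UE'] := submodule_vspaceP (bpoly_submodule s' (lspan_submodule G)).
rewrite (setdim_restr_perp st Gt UE) (setdim_restr_perp (leq_trans s's st) Gt UE').
pose iota := linfun (widen s's) => dE p ps.
have dimi V : \dim (iota @: V) = \dim V.
  by rewrite limg_dim_eq // lker_widen capv0.
have cap : (limg iota :&: U)%VS = (iota @: U')%VS.
  apply/vspaceP => x; apply/memv_capP/memv_imgP.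
    case=> /memv_imgP [y _ ->] /UE; rewrite lfunE => /UE' Uy.
    by exists y; rewrite ?lfunE.
  case=> y /UE' Uy ->; split; first by rewrite memv_img ?memvf.
  by apply/UE; rewrite lfunE.
(* These bounds make the truncated subtractions in [dE] exact. *)
have dU : (\dim U <= dim (bpoly n R s))%N by rewrite -dimvf dimvS ?subvf.
have dU' : (\dim U' <= dim (bpoly n R s'))%N by rewrite -dimvf dimvS ?subvf.
have /eqP full : (limg iota + U)%VS == fullv.
  rewrite eqEdim subvf /= -(leq_add2r (\dim (limg iota :&: U))) dimv_sum_cap cap.
  by rewrite !dimi !dimvf -(subnK dU) dE addnAC subnK.
have : BPoly ps \in (limg iota + U)%VS by rewrite full memvf.
case/memv_addP => _ /memv_imgP [q _ ->] [u /UE Uu /(congr1 val)].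
rewrite lfunE /= => pE; exists (val q); first by case: q {pE}.
by rewrite pE addrC addKr.
Qed.

(** Nested subspaces of R[x]_s with equal codimension coincide. *)
Lemma restr_perp_dim_mono G G' s t t' : (s <= t)%N -> (s <= t')%N ->
    G `<=` deg_le t ->
    G' `<=` deg_le t' -> G `<=` G' ->
    setdim (restr s (perp t G)) = setdim (restr s (perp t' G')) ->
  forall p, mpoly_deg_le s p -> lspan G' p -> lspan G p.
Proof.
move=> st st' Gt Gt' GG'.
have [U UE] := submodule_vspaceP (bpoly_submodule s (lspan_submodule G)).
have [U' UE'] := submodule_vspaceP (bpoly_submodule s (lspan_submodule G')).
rewrite (setdim_restr_perp st Gt UE) (setdim_restr_perp st' Gt' UE') => dE p ps G'p.
have dU (V : {vspace bpoly n R s}) : (\dim V <= dim (bpoly n R s))%N.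
  by rewrite -dimvf dimvS ?subvf.
have /eqP UU' : U == U'.
  rewrite eqEdim -(subKn (dU U')) -dE subKn ?leqnn ?andbT //.
  by apply/subvP => q /UE Gq; apply/UE'; exact: lspan_mono Gq.
by apply/(UE (BPoly ps)); rewrite UU'; apply/UE'.
Qed.

(** Used with T = Span(B), both to see that Span(B) is nonzero and to compare its dimension with the
    number of real zeros. *)
Lemma restr_perp_dim_complement G s t (T : set {mpoly R[n]}) : (s <= t)%N ->
    G `<=` deg_le t -> is_submodule T ->
    direct_sum (deg_le s) T (deg_le s `&` lspan G) ->
  exists2 U : {vspace bpoly n R s}, (forall p : bpoly n R s, p \in U <-> T (val p)) &
    \dim U = setdim (restr s (perp t G)).
Proof.
move=> st Gt subT dS.
have [U UE] := submodule_vspaceP (bpoly_submodule s subT).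
have [W WE] := submodule_vspaceP (bpoly_submodule s (lspan_submodule G)).
exists U => //; rewrite (setdim_restr_perp st Gt WE).
have W0 : (deg_le s `&` lspan G) 0.
  exact: submodule0 (is_submoduleI (mpoly_deg_le_submodule s) (lspan_submodule G)).
have cap0 : (U :&: W = 0)%VS.
  apply/eqP; rewrite -subv0; apply/subvP => p /memv_capP [/UE Up /WE Wp].
  rewrite memv0; apply/eqP/val_inj; apply: (direct_sum0 dS) => //.
  by split=> //; exact: valP.
have full : (U + W = fullv)%VS.
  apply/eqP; rewrite eqEsubv subvf /=; apply/subvP => p _.
  have [u Tu [ws Ww]] := direct_sum_ex dS (valP p : deg_le s (val p)).
  have us : mpoly_deg_le s u := direct_sum_subl dS W0 Tu.
  apply/memv_addP; exists (BPoly us); first exact/UE.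
  by exists (BPoly ws); [exact/WE | apply: val_inj; rewrite /= addrC subrK].
by rewrite -dimvf -full dimv_disjoint_sum // addnK.
Qed.

End TruncatedSpans.

(** * Ideals, real zeros and the real radical *)

Section Ideals.
Variables (R : realType) (n : nat).
Implicit Types (I S T : set {mpoly R[n]}) (p q : {mpoly R[n]}).

Definition is_ideal T := T 0 /\ forall p u v, T u -> T v -> T (p * u + v).

Section Closure.
Variables (T : set {mpoly R[n]}) (idealT : is_ideal T).

Lemma ideal0 : T 0. Proof. by case: idealT. Qed.

Lemma idealM p u : T u -> T (p * u).
Proof. by move=> Tu; rewrite -[_ * _]addr0; apply: idealT.2 => //; exact: ideal0. Qed.

Lemma idealD u v : T u -> T v -> T (u + v).
Proof. by move=> Tu Tv; rewrite -[u]mul1r; exact: idealT.2. Qed.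

Lemma ideal_submodule : is_submodule T.
Proof.
split; first exact: ideal0.
by move=> a u v Tu Tv; rewrite -mul_mpolyC; exact: idealT.2.
Qed.

End Closure.

Lemma ideal_gen_ideal S : is_ideal (ideal_gen S).
Proof.
split; first by exists 0%N, (fun=> 0), (fun=> 0); split; [case | rewrite big_ord0].
move=> a u v [k [c [f [Sf ->]]]] [l [d [g [Sg ->]]]].
exists (k + l)%N, (fun i => match fintype.split i with inl i => a * c i | inr i => d i end),
  (fun i => match fintype.split i with inl i => f i | inr i => g i end).
split; first by move=> i; case: (fintype.split i).
rewrite big_split_ord /= mulr_sumr; congr (_ + _); apply: eq_bigr => i _.
  by rewrite -[lshift l i]/(unsplit (inl i)) unsplitK mulrA.
by rewrite -[rshift k i]/(unsplit (inr i)) unsplitK.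
Qed.

Lemma sub_ideal_gen S : S `<=` ideal_gen S.
Proof.
move=> p Sp; exists 1%N, (fun=> 1), (fun=> p); split=> //.
by rewrite big_ord_recl big_ord0 addr0 mul1r.
Qed.

Lemma ideal_gen_min S T : is_ideal T -> S `<=` T -> ideal_gen S `<=` T.
Proof.
move=> idealT ST p [k [c [f [Sf ->]]]].
apply: (submodule_sum (ideal_submodule idealT)) => i _.
by apply: idealM => //; exact/ST/Sf.
Qed.

Lemma lspan_ideal S T : is_ideal T -> S `<=` T -> lspan S `<=` T.
Proof. by move=> idealT; apply: lspan_min; exact: ideal_submodule. Qed.

Lemma prolong_deg_le t S : S `<=` deg_le t -> prolong S `<=` deg_le t.+1.
Proof.
move=> St p [/St pt | [i [q [/St qt ->]]]]; first exact: mpoly_deg_le_trans pt.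
have [->|q0] := eqVneq q 0.
  by rewrite mulr0 /= /mpoly_deg_le msize0.
have X0 : 'X_i != 0 :> {mpoly R[n]} by rewrite -msize_poly_eq0 msizeX.
by rewrite /= /mpoly_deg_le msizeM // msizeX mdeg1.
Qed.

(** Multiplication by ['X_i] is linear. This is needed because W consists of combinations of
    elements of G. *)
Lemma prolong_lspan S : lspan (prolong (lspan S)) `<=` lspan (prolong S).
Proof.
have subP := lspan_submodule (prolong S).
apply: lspan_min => // p [Sp | [i [q [Sq ->]]]].
  by apply: lspan_mono Sp => q; left.
pose T : set {mpoly R[n]} := [set q | lspan (prolong S) ('X_i * q)].
apply: (@lspan_min _ _ _ T) Sq => [|r Sr]; last first.
  by apply: sub_lspan; right; exists i, r.
split=> [|a u v Tu Tv]; rewrite /T /= ?mulr0; first exact: submodule0 subP.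
by rewrite mulrDr -scalerAr; exact: subP.2.
Qed.

End Ideals.

Section Zeros.
Variables (R : realType) (n : nat).
Implicit Types (I S T : set {mpoly R[n]}) (p q : {mpoly R[n]}).

(** Bundled as a ring morphism so that the morphism laws apply to the evaluation in [VC]. *)
Definition ceval (z : 'I_n -> R[i]) : {rmorphism {mpoly R[n]} -> R[i]} :=
  meval z \o map_mpoly (real_complex R).

Lemma cevalE z p : (map_mpoly (real_complex R) p).@[z] = ceval z p.
Proof. by []. Qed.

Lemma ceval_real (v : 'rV[R]_n) p :
  ceval (map_mx (real_complex R) v ord0) p = real_complex R p.@[v ord0].
Proof.
elim/mpolyind: p => [|c m p _ _ IH]; first by rewrite !rmorph0.
rewrite !rmorphD IH; congr (_ + _).
rewrite -mul_mpolyC !rmorphM; congr (_ * _).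
  by rewrite -cevalE map_mpolyC mevalC /= mevalC.
rewrite mpolyXE_id !rmorph_prod /=; apply: eq_bigr => i _.
rewrite !rmorphXn /=; congr (_ ^+ _).
by rewrite map_mpolyX !mevalXU mxE.
Qed.

Lemma VRP I (v : 'rV[R]_n) : VR I v <-> forall p, I p -> p.@[v ord0] = 0.
Proof.
split=> v0 p Ip; first by have := v0 p Ip; rewrite cevalE ceval_real => /complexI.
by rewrite cevalE ceval_real v0 // rmorph0.
Qed.

Lemma meval_ideal (v : 'rV[R]_n) : is_ideal [set p | p.@[v ord0] = 0].
Proof.
split=> [|p u w /= u0 w0]; first by rewrite /= rmorph0.
by rewrite rmorphD rmorphM /= u0 w0 mulr0 addr0.
Qed.

End Zeros.

(** * Sums of squares and the real radical *)

Section RealRadical.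
Variables (R : realType) (n : nat).
Implicit Types (I : set {mpoly R[n]}) (p q : {mpoly R[n]}).

Definition sum_of_squares : set {mpoly R[n]} :=
  [set p | exists q : seq {mpoly R[n]}, p = \sum_(f <- q) f ^+ 2].

Lemma sosX2 p : sum_of_squares (p ^+ 2).
Proof. by exists [:: p]; rewrite big_seq1. Qed.

Lemma sos0 : sum_of_squares 0.
Proof. by exists [::]; rewrite big_nil. Qed.

Lemma sosD p q : sum_of_squares p -> sum_of_squares q -> sum_of_squares (p + q).
Proof. by move=> [f ->] [g ->]; exists (f ++ g); rewrite big_cat. Qed.

Lemma sosM p q : sum_of_squares p -> sum_of_squares q -> sum_of_squares (p * q).
Proof.
move=> [f ->] [g ->]; exists [seq a * b | a <- f, b <- g].
rewrite big_allpairs_dep mulr_suml; apply: eq_bigr => a _; rewrite mulr_sumr.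
by apply: eq_bigr => b _; rewrite exprMn.
Qed.

Lemma sosXn p k : sum_of_squares p -> sum_of_squares (p ^+ k).
Proof.
move=> sp; elim: k => [|k IH]; last by rewrite exprS; exact: sosM.
by rewrite expr0 -(expr1n _ 2); exact: sosX2.
Qed.

Lemma sosD_expr p q k : sum_of_squares p -> sum_of_squares q ->
  exists2 r, sum_of_squares r & (p + q) ^+ k = p ^+ k + r.
Proof.
move=> sp sq; elim: k => [|k [r sr IH]].
  by exists 0; [exact: sos0 | rewrite !expr0 addr0].
exists (p * r + q * p ^+ k + q * r); last by rewrite !exprS IH; ring.
by do !apply: sosD; apply: sosM => //; exact: sosXn.
Qed.

Section ModuloIdeal.
Variables (I : set {mpoly R[n]}) (idealI : is_ideal I).

(** Read as p <= 0 modulo [I]; p is in the real radical when some power of p^2 with positive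
    exponent has this property. *)
Let nonpos : set {mpoly R[n]} := [set p | exists2 r, sum_of_squares r & I (p + r)].

Let nonposD p q : nonpos p -> nonpos q -> nonpos (p + q).
Proof.
move=> [a sa Ia] [b sb Ib]; exists (a + b); first exact: sosD.
by rewrite addrACA; exact: idealD.
Qed.

Let nonposM p q : nonpos p -> sum_of_squares q -> nonpos (p * q).
Proof.
move=> [a sa Ia] sq; exists (a * q); first exact: sosM.
by rewrite -mulrDl mulrC; exact: idealM.
Qed.

(** In a binomial term p^(k+l-i) q^i either i >= l or k+l-i >= k, so q^l or p^k splits off, with a
    sum of squares as cofactor. *)
Let nonpos_expr p q k l : sum_of_squares p -> sum_of_squares q ->
  nonpos (p ^+ k) -> nonpos (q ^+ l) -> nonpos ((p + q) ^+ (k + l)).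
Proof.
move=> sp sq np nq; rewrite exprDn.
have n0 : nonpos 0 by exists 0; [exact: sos0 | rewrite addr0; exact: ideal0].
apply: (big_ind nonpos) => //= -[i /= lei] _.
have nterm : nonpos (p ^+ (k + l - i) * q ^+ i).
  have [li|il] := leqP l i.
    have -> : q ^+ i = q ^+ l * q ^+ (i - l) by rewrite -exprD subnKC.
    rewrite mulrCA.
    by apply: nonposM => //; apply: sosM; exact: sosXn.
  have -> : (k + l - i = k + (l - i))%N by rewrite addnBA // ltnW.
  by rewrite exprD -mulrA; apply: nonposM => //; apply: sosM; exact: sosXn.
by elim: 'C(_, _) => [|c IH]; rewrite ?mulr0n // mulrS; exact: nonposD.
Qed.

Lemma real_radicalP p :
  real_radical I p <-> exists2 k, (1 <= k)%N & nonpos ((p ^+ 2) ^+ k).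
Proof.
split=> [[k [q [k1 Iq]]]|[k k1 [_ [q ->] Iq]]].
  by exists k => //; exists (\sum_(f <- q) f ^+ 2); [exists q | rewrite -exprM].
by exists k, q; split; rewrite ?exprM.
Qed.

(* (p + q)^2 + (p - q)^2 = 2 (p^2 + q^2), and a high power of the right-hand
   side is a combination of a power of p^2 and a power of q^2. *)
Lemma real_radicalD p q :
  real_radical I p -> real_radical I q -> real_radical I (p + q).
Proof.
move=> /real_radicalP [k k1 np] /real_radicalP [l l1 nq].
apply/real_radicalP; exists (k + l)%N; first by rewrite addn_gt0 k1.
have [r sr rE] := sosD_expr (k + l) (sosX2 (p + q)) (sosX2 (p - q)).
have : nonpos (((p + q) ^+ 2 + (p - q) ^+ 2) ^+ (k + l)).
  have -> : (p + q) ^+ 2 + (p - q) ^+ 2 = (p ^+ 2 + q ^+ 2) * (1 ^+ 2 + 1 ^+ 2) by ring.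
  rewrite exprMn; apply: nonposM; first by apply: nonpos_expr => //; exact: sosX2.
  by apply/sosXn/sosD; exact: sosX2.
rewrite rE => -[r' sr' Ir]; exists (r + r'); first exact: sosD.
by rewrite addrA.
Qed.

Lemma real_radical_ideal : is_ideal (real_radical I).
Proof.
split.
  exists 1%N, [::]; split=> //; rewrite big_nil addr0 expr0n; exact: ideal0.
move=> p u v ru rv; apply: real_radicalD => //.
have /real_radicalP [k k1 nu] := ru; apply/real_radicalP; exists k => //.
by rewrite (exprMn 2) (exprMn k) mulrC; apply: nonposM => //; apply: sosXn; exact: sosX2.
Qed.

End ModuloIdeal.

(** At a real zero of [I], nonnegative reals add up to 0, so p^(2k) vanishes there, and k >= 1 gives
    the same for p. *)
Lemma real_radical_vanish I p (v : 'rV[R]_n) :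
  VR I v -> real_radical I p -> p.@[v ord0] = 0.
Proof.
move=> /VRP Iv [k [q [k1 /Iv]]].
rewrite rmorphD rmorphXn rmorph_sum /= => /eqP.
have sq_ge0 (x : R) : 0 <= x ^+ 2 by exact: Num.Theory.sqr_ge0.
rewrite Num.Theory.paddr_eq0.
- by rewrite expf_eq0 muln_gt0 k1 => /andP [/eqP].
- by rewrite exprM Num.Theory.exprn_ge0.
- by apply: Num.Theory.sumr_ge0 => f _; rewrite rmorphXn.
Qed.

End RealRadical.

(** * Interpolation at finitely many real points *)

Section Interpolation.
Variables (R : realType) (n d : nat) (v : 'I_d -> 'rV[R]_n).
Hypothesis v_inj : injective v.

Lemma lagrange_basis :
  exists e : 'I_d -> {mpoly R[n]}, forall i j, (e i).@[v j ord0] = (i == j)%:R.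
Proof.
have sep i j : exists l : {mpoly R[n]},
    i != j -> l.@[v i ord0] = 1 /\ l.@[v j ord0] = 0.
  have [->|ne_ij] := eqVneq i j; first by exists 0.
  have [k vk] : exists k, v i ord0 k != v j ord0 k.
    apply/existsP; apply: contraNT ne_ij => /existsPn vE; apply/eqP/v_inj/rowP => k.
    exact/eqP/negPn/vE.
  (* An affine function of a coordinate in which the two points differ. *)
  exists ((v i ord0 k - v j ord0 k)^-1 *: ('X_k - (v j ord0 k)%:MP)) => _.
  rewrite !mevalZ !mevalB !mevalXU !mevalC subrr mulr0 mulVf // subr_eq0 //.
have [l lP] := choice (fun ij : 'I_d * 'I_d => sep ij.1 ij.2).
exists (fun i => \prod_(j | j != i) l (i, j)) => i j; rewrite rmorph_prod /=.
case: eqVneq => [<-|ne_ij].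
  by apply: big1 => k ne_ki; have [] := lP (i, k); rewrite // eq_sym.
by rewrite (bigD1 j) ?(eq_sym j) //=; have [_ /= ->] := lP (i, j) ne_ij; rewrite mul0r.
Qed.

(** Evaluation maps [U] onto R^d, since combinations of Lagrange polynomials have representatives in
    [U] with the same values; as dim U = d, it is injective on [U]. *)
Lemma vanishing_in_subspace s (U : {vspace bpoly n R s}) :
    \dim U = d ->
    (forall p, exists2 q : bpoly n R s,
       q \in U & forall i, (val q).@[v i ord0] = p.@[v i ord0]) ->
  forall q : bpoly n R s,
    q \in U -> (forall i, (val q).@[v i ord0] = 0) -> q = 0.
Proof.
move=> dU nf q Uq q0.
pose ev (p : bpoly n R s) : 'rV[R]_d := \row_i (val p).@[v i ord0].
have ev_lin : linear ev.
  by move=> a p p'; apply/rowP => i; rewrite !mxE /= mevalD mevalZ.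
pose evL : {linear _ -> _} := HB.pack ev (GRing.isLinear.Build _ _ _ _ _ ev_lin).
pose f := linfun evL.
have [e eE] := lagrange_basis.
have imf : (f @: U = fullv)%VS.
  apply/eqP; rewrite eqEsubv subvf /=; apply/subvP => r _; apply/memv_imgP.
  have [p Up pE] := nf (\sum_i r 0 i *: e i).
  exists p => //; rewrite lfunE; apply/rowP => j; rewrite mxE pE raddf_sum /=.
  rewrite (bigD1 j) //= mevalZ eE eqxx mulr1 big1 ?addr0 // => i ne_ij.
  by rewrite mevalZ eE (negbTE ne_ij) mulr0.
have := limg_ker_dim f U; rewrite imf dimvf dU.
have -> : dim 'rV[R]_d = d by exact: mul1n.
rewrite -[RHS]add0n => /addIn /eqP; rewrite dimv_eq0 => /eqP cap0.
have : q \in (U :&: lker f)%VS.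
  rewrite memv_cap Uq memv_ker lfunE; apply/eqP/rowP => i.
  by rewrite !mxE q0.
by rewrite cap0 memv0 => /eqP.
Qed.

End Interpolation.

(** Induction on the degree, peeling off one variable at a time to match prolongation. *)
Lemma monomial_ind n (P : 'X_{1..n} -> Prop) :
  P 0%MM -> (forall i m, P m -> P (U_(i) + m)%MM) -> forall m, P m.
Proof.
move=> P0 PS m; move: {2}(mdeg m) (erefl (mdeg m)) => d.
elim: d m => [|d IH] m; first by move/eqP; rewrite mdeg_eq0 => /eqP ->.
move=> dm; have [i mi] : exists i, m i != 0%N.
  apply/existsP; apply: contraPT dm => /existsPn m0.
  have -> : m = 0%MM by apply/mnmP => i; rewrite mnm0E; apply/eqP/negPn/m0.
  by rewrite mdeg0.
have mE : m = (U_(i) + (m - U_(i)))%MM by rewrite addmC submK // lep1mP.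
by rewrite mE; apply/PS/IH; move: dm; rewrite {1}mE mdegD mdeg1 => -[].
Qed.

(** * Normal forms with respect to a border basis *)

Section BorderBasis.
Variables (R : realType) (n s : nat) (B : set 'X_{1..n}).
Variables (W : set {mpoly R[n]}) (phi : {mpoly R[n]} -> {mpoly R[n]}).
Local Notation spanB := (@mono_span n R B).

Hypothesis B_deg : forall b, B b -> (mdeg b < s)%N.
Hypothesis B_unit : B 0%MM.
Hypothesis subW : is_submodule W.
Hypothesis sumBW : direct_sum (deg_le s) spanB W.
Hypothesis phiP : projection_onto_along spanB W phi.
Hypothesis W_prolong : forall p, mpoly_deg_le s p -> lspan (prolong W) p -> W p.

Let subB : is_submodule spanB := lspan_submodule _.

Lemma mono_span_X b : B b -> spanB 'X_[b].
Proof. by move=> Bb; apply: sub_lspan; exists b. Qed.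

Lemma mono_span_deg u : spanB u -> mpoly_deg_le s u.
Proof. exact: (direct_sum_subl sumBW (submodule0 subW)). Qed.

Lemma complement_deg w : W w -> mpoly_deg_le s w.
Proof.
move=> Ww; have: (deg_le s) w by case: sumBW => -> _; exists 0, w; split;
  [exact: submodule0 subB | | rewrite add0r].
by [].
Qed.

Lemma phi_span u : spanB u -> phi u = u.
Proof. by move=> Bu; rewrite -{1}[u]addr0 phiP //; exact: submodule0 subW. Qed.

Lemma phi_complement w : W w -> phi w = 0.
Proof. by move=> Ww; rewrite -[w]add0r phiP //; exact: submodule0 subB. Qed.

Lemma phi_spec p : mpoly_deg_le s p -> spanB (phi p) /\ W (p - phi p).
Proof.
move=> ps; have [u Bu Ww] := direct_sum_ex sumBW (ps : deg_le s p).
suff -> : phi p = u by [].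
by rewrite -(subrK u p) addrC phiP.
Qed.

(** [phi] is constrained only on Span(B) + W = R[x]_s, hence the degree bounds. *)
Lemma phi_linear a p q : mpoly_deg_le s p -> mpoly_deg_le s q ->
  phi (a *: p + q) = a *: phi p + phi q.
Proof.
move=> /phi_spec [Bp Wp] /phi_spec [Bq Wq].
rewrite -[a *: p + q](subrK (a *: phi p + phi q)) addrC phiP //.
  exact: subB.2.
by rewrite opprD addrACA -scalerBr; exact: subW.2.
Qed.

Lemma phiB p q : mpoly_deg_le s p -> mpoly_deg_le s q ->
  phi (p - q) = phi p - phi q.
Proof. by move=> ps qs; rewrite addrC -scaleN1r phi_linear // scaleN1r addrC. Qed.

Lemma phi_lincomb (I : eqType) (r : seq I) (c : I -> R) (f : I -> {mpoly R[n]}) :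
    {in r, forall i, mpoly_deg_le s (f i)} ->
  phi (\sum_(i <- r) c i *: f i) = \sum_(i <- r) c i *: phi (f i).
Proof.
elim: r => [|i r IH] fs.
  by rewrite !big_nil phi_complement //; exact: submodule0 subW.
have fr : {in r, forall j, mpoly_deg_le s (f j)}.
  by move=> j jr; apply: fs; rewrite inE jr orbT.
rewrite !big_cons phi_linear ?IH ?fs ?mem_head //.
have subs := mpoly_deg_le_submodule R n s.
rewrite big_seq; apply: (submodule_sum subs) => j /fr.
exact: (submoduleZ subs).
Qed.

Lemma deg_le_mulX i u : spanB u -> mpoly_deg_le s ('X_i * u).
Proof.
have subs := mpoly_deg_le_submodule R n s.
pose T : set {mpoly R[n]} := [set u | mpoly_deg_le s ('X_i * u)].
apply: (@lspan_min _ _ _ T).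
  split=> [|a v w Tv Tw]; rewrite /T /= ?mulr0; first exact: submodule0 subs.
  by rewrite mulrDr -scalerAr; exact: (subs.2 a).
move=> _ [b Bb <-]; rewrite /T /= -mpolyXD /mpoly_deg_le msizeX mdegD mdeg1.
exact: B_deg.
Qed.

(** Multiplication by x_i in the quotient by J, transported to Span(B). *)
Definition mulop i v := phi ('X_i * v).

Lemma mulop_span i v : spanB v -> spanB (mulop i v).
Proof. by move=> Bv; case: (phi_spec (deg_le_mulX i Bv)). Qed.

Lemma mulop_linear i a u v : spanB u -> spanB v ->
  mulop i (a *: u + v) = a *: mulop i u + mulop i v.
Proof.
by move=> Bu Bv; rewrite /mulop mulrDr -scalerAr phi_linear //; exact: deg_le_mulX.
Qed.

Lemma mulopC i j v : spanB v -> mulop i (mulop j v) = mulop j (mulop i v).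
Proof.
move=> Bv.
have [[Bi Wi] [Bj Wj]] := (phi_spec (deg_le_mulX i Bv), phi_spec (deg_le_mulX j Bv)).
have [di dj] := (deg_le_mulX j Bi, deg_le_mulX i Bj).
apply/eqP; rewrite -subr_eq0 -phiB //; apply/eqP/phi_complement/W_prolong.
  exact: submoduleB (mpoly_deg_le_submodule R n s) _ _ _ _.
(* The term x_i x_j v cancels, leaving variables times elements of W. *)
have -> : 'X_i * mulop j v - 'X_j * mulop i v =
    'X_j * ('X_i * v - mulop i v) - 'X_i * ('X_j * v - mulop j v) by ring.
apply: submoduleB; try exact: lspan_submodule.
  by apply: sub_lspan; right; exists j, ('X_i * v - mulop i v).
by apply: sub_lspan; right; exists i, ('X_j * v - mulop j v).
Qed.

Definition monomial_word (m : 'X_{1..n}) : seq 'I_n :=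
  flatten [seq nseq (m i) i | i <- enum 'I_n].

Lemma count_monomial_word m i : count_mem i (monomial_word m) = m i.
Proof.
rewrite /monomial_word count_flatten -map_comp sumnE big_map big_enum /=.
rewrite (bigD1 i) //= count_nseq /= eqxx mul1n big1 ?addn0 // => j ne_ji.
by rewrite count_nseq /= (negbTE ne_ji).
Qed.

Lemma foldr_mulop_span w : spanB (foldr mulop 1 w).
Proof.
elim: w => [|i w IH] /=; last exact: mulop_span.
by rewrite -mpolyX0; exact: mono_span_X.
Qed.

(** The operators are known to commute only on Span(B), so each exchange carries the hypothesis
    [spanB v], which every operator preserves. *)
Lemma foldr_mulop_perm w1 w2 : perm_eq w1 w2 ->
  foldr mulop 1 w1 = foldr mulop 1 w2.
Proof.
have comm i w v : spanB v -> mulop i (foldr mulop v w) = foldr mulop (mulop i v) w.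
  elim: w => //= j w IH Bv; rewrite mulopC ?IH //.
  by elim: (w) => //= k w' ?; exact: mulop_span.
have commw w w' v : spanB v ->
    foldr mulop (foldr mulop v w') w = foldr mulop (foldr mulop v w) w'.
  move=> Bv; elim: w => //= i w ->; apply: comm.
  by elim: (w) => //= k w'' ?; exact: mulop_span.
move=> perm; apply/esym; pose P w := foldr mulop 1 w = foldr mulop 1 w1.
apply: (@catCA_perm_ind _ P _ w1) => // w w' w''.
by rewrite /P !foldr_cat commw //; exact: foldr_mulop_span.
Qed.

Definition mononf m := foldr mulop 1 (monomial_word m).

(** The word of x_i m is only a permutation of i followed by the word of m; commutation makes the
    order immaterial. *)
Lemma mononfX i m : mononf (U_(i) + m)%MM = mulop i (mononf m).
Proof.
rewrite /mononf -[RHS]/(foldr mulop 1 (i :: monomial_word m)).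
apply/foldr_mulop_perm/allP => j _ /=.
by rewrite !count_monomial_word mnmDE mnm1E eq_sym.
Qed.

Lemma mononf0 : mononf 0%MM = 1.
Proof.
rewrite /mononf -[RHS]/(foldr mulop 1 [::]).
by apply/foldr_mulop_perm/allP => j _ /=; rewrite count_monomial_word mnm0E.
Qed.

Definition normal_form (p : {mpoly R[n]}) : {mpoly R[n]} :=
  \sum_(m <- msupp p) p@_m *: mononf m.

(** A common degree bound gives the sums for p, q and a p + q the same index set, whence
    linearity. *)
Lemma normal_formwE k p : (msize p <= k)%N ->
  normal_form p = \sum_(m : 'X_{1..n < k}) p@_m *: mononf m.
Proof.
move=> pk; rewrite /normal_form (big_mksub 'X_{1..n < k}) //=; first last.
- by move=> m /msize_mdeg_lt /leq_trans; apply.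
- exact: msupp_uniq.
by rewrite big_rmcond //= => m; move/memN_msupp_eq0 ->; rewrite scale0r.
Qed.

Fact normal_form_linear : linear normal_form.
Proof.
move=> a p q; pose k := maxn (msize (a *: p + q)) (maxn (msize p) (msize q)).
rewrite !(@normal_formwE k) ?leq_max ?leqnn ?orbT // scaler_sumr -big_split /=.
by apply: eq_bigr => m _; rewrite mcoeffD mcoeffZ scalerDl scalerA.
Qed.

HB.instance Definition _ :=
  GRing.isLinear.Build R _ _ _ normal_form normal_form_linear.

Lemma normal_form_X m : normal_form 'X_[m] = mononf m.
Proof. by rewrite /normal_form msuppX big_seq1 mcoeffX eqxx scale1r. Qed.

Lemma normal_form_span p : spanB (normal_form p).
Proof.
apply: (submodule_sum subB) => m _; apply: (submoduleZ subB).
exact: foldr_mulop_span.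
Qed.

Lemma normal_form_mulX i p : normal_form ('X_i * p) = mulop i (normal_form p).
Proof.
elim/mpolyind: p => [|c m p _ _ IH].
  rewrite mulr0 linear0 /mulop mulr0; exact: esym (phi_span (submodule0 subB)).
rewrite mulrDr -scalerAr !linearD !linearZ /= IH -mpolyXD !normal_form_X mononfX.
by rewrite mulop_linear //; [exact: foldr_mulop_span | exact: normal_form_span].
Qed.

(** By induction on monomials: phi(x_i phi(m)) = phi(x_i m), because x_i (m - phi(m)) is in W by
    [W_prolong]. The start is 1, which lies in Span(B) and is fixed by [phi]. *)
Lemma normal_form_phi p : mpoly_deg_le s p -> normal_form p = phi p.
Proof.
suff X m : (mdeg m <= s)%N -> normal_form 'X_[m] = phi 'X_[m].
  rewrite /mpoly_deg_le msizeE => /bigmax_leqP_seq ps.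
  rewrite /normal_form [in RHS](mpolyE p) phi_lincomb => [|m /ps ms].
    by apply: eq_big_seq => m /ps ms; rewrite -X ?normal_form_X // -ltnS ms.
  by rewrite /mpoly_deg_le msizeX ms.
elim/monomial_ind: m => [_|i m IH].
  rewrite normal_form_X mononf0 mpolyX0 phi_span // -mpolyX0.
  exact: mono_span_X.
rewrite mdegD mdeg1 => ms.
have Xs : mpoly_deg_le s ('X_[m] : {mpoly R[n]}).
  by rewrite /mpoly_deg_le msizeX ltnS ltnW.
have Xms : mpoly_deg_le s ('X_[U_(i) + m] : {mpoly R[n]}).
  by rewrite /mpoly_deg_le msizeX ltnS mdegD mdeg1.
have [Bm Wm] := phi_spec Xs.
rewrite mpolyXD normal_form_mulX IH ?(ltnW ms) // /mulop.
have dX := deg_le_mulX i Bm; rewrite mpolyXD in Xms.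
apply/esym/eqP; rewrite -subr_eq0 -phiB // -mulrBr; apply/eqP.
apply/phi_complement/W_prolong.
  by rewrite mulrBr; exact: submoduleB (mpoly_deg_le_submodule R n s) _ _ _ _.
by apply: sub_lspan; right; exists i, ('X_[m] - phi 'X_[m]).
Qed.

Let F0 : set {mpoly R[n]} := [set 'X_[b] - phi 'X_[b] | b in border B].
Let J := ideal_gen F0.
Let idealJ : is_ideal J := ideal_gen_ideal F0.

Lemma border_deg b : border B b -> mpoly_deg_le s ('X_[b] : {mpoly R[n]}).
Proof.
rewrite /mpoly_deg_le msizeX ltnS => -[[/B_deg /ltnW //|[i [m [/B_deg ms ->]]]] _].
by rewrite mdegD mdeg1.
Qed.

Lemma border_sub : F0 `<=` W.
Proof. by move=> _ [b /border_deg /phi_spec [_ ?] <-]. Qed.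

(** By [normal_form_mulX], multiplying by a variable applies an operator that sends 0 to 0. *)
Lemma normal_form_ideal : is_ideal [set p | normal_form p = 0].
Proof.
split=> [|p u v /= u0 v0]; first exact: linear0.
rewrite linearD /= v0 addr0.
elim/mpolyind: p => [|c m p _ _ IH]; first by rewrite mul0r linear0.
rewrite mulrDl linearD /= IH -scalerAl linearZ /= addr0.
suff -> : normal_form ('X_[m] * u) = 0 by rewrite scaler0.
elim/monomial_ind: m => [|i m IHm]; first by rewrite mpolyX0 mul1r.
rewrite mpolyXD -mulrA normal_form_mulX IHm /mulop mulr0.
by apply: phi_span; exact: submodule0 subB.
Qed.

(** For b in B, either x_i b is in B and the difference is 0, or x_i b is in the border and the
    difference is in [F0]. *)
Lemma mulop_mod i u : spanB u -> J ('X_i * u - mulop i u).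
Proof.
pose T : set {mpoly R[n]} := [set u | spanB u /\ J ('X_i * u - mulop i u)].
suff TE : spanB `<=` T by move=> /TE [].
apply: lspan_min => [|_ [b Bb <-]].
  split=> [|a v w [Bv Jv] [Bw Jw]].
    split; first exact: submodule0 subB.
    rewrite mulr0 /mulop mulr0 phi_span ?subr0; first exact: ideal0.
    exact: submodule0 subB.
  split; first exact: subB.2.
  rewrite mulop_linear // mulrDr opprD addrACA -scalerAr -scalerBr.
  exact: (ideal_submodule idealJ).2.
split; first exact: mono_span_X.
rewrite /mulop -mpolyXD.
have [Bib|Bib] := pselect (B (U_(i) + b)%MM).
  by rewrite phi_span ?subrr; [exact: ideal0 | exact: mono_span_X].
apply: sub_ideal_gen; exists (U_(i) + b)%MM => //.
by split=> //; right; exists i, b.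
Qed.

Lemma normal_form_mod p : J (p - normal_form p).
Proof.
have subJ := ideal_submodule idealJ.
suff X m : J ('X_[m] - normal_form 'X_[m]).
  elim/mpolyind: p => [|c m p _ _ IH]; first by rewrite linear0 subrr; exact: ideal0.
  rewrite linearD linearZ /= opprD addrACA -scalerBr.
  exact: subJ.2.
elim/monomial_ind: m => [|i m IH].
  by rewrite normal_form_X mononf0 mpolyX0 subrr; exact: ideal0.
rewrite mpolyXD normal_form_mulX.
(* The error splits into x_i times the error at m, plus the error of [mulop] at the normal form of
   m. *)
rewrite -(subrK ('X_i * normal_form 'X_[m]) ('X_i * 'X_[m])) -addrA -mulrBr.
by apply: idealJ.2 => //; apply/mulop_mod/normal_form_span.
Qed.

(** The kernel of [normal_form] is an ideal containing [F0], which lies in W; conversely p is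
    congruent to its normal form modulo J. *)
Lemma border_ideal_normal_form p : J p <-> normal_form p = 0.
Proof.
split=> [|nf0]; last by rewrite -[p]subr0 -nf0; exact: normal_form_mod.
apply: (ideal_gen_min normal_form_ideal) p => p /border_sub Wp /=.
by rewrite normal_form_phi ?phi_complement //; exact: complement_deg.
Qed.

Lemma border_ideal_deg_le p : mpoly_deg_le s p -> J p <-> W p.
Proof.
move=> ps; rewrite border_ideal_normal_form normal_form_phi //.
split=> [phi0|]; last exact: phi_complement.
by rewrite -[p]subr0 -phi0; case: (phi_spec ps).
Qed.

Lemma mono_span_border_ideal u : spanB u -> J u -> u = 0.
Proof.
move=> Bu /border_ideal_normal_form.
by rewrite normal_form_phi ?phi_span //; exact: mono_span_deg.
Qed.

Lemma border_quotient_basis : quotient_basis B J.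
Proof.
split=> [ms c ums msB Jc m mms|p]; last first.
  by exists (normal_form p); [exact: normal_form_span | exact: normal_form_mod].
have /(congr1 (mcoeff m)) : \sum_(m <- ms) c m *: 'X_[m] = 0 :> {mpoly R[n]}.
  apply: mono_span_border_ideal => //; rewrite big_seq.
  apply: (submodule_sum subB) => k kms; apply: (submoduleZ subB).
  exact/mono_span_X/msB.
rewrite mcoeff0 raddf_sum /= (bigD1_seq m) //= mcoeffZ mcoeffX eqxx mulr1.
rewrite big1 ?addr0 // => k ne_km.
by rewrite mcoeffZ mcoeffX (negbTE ne_km) mulr0.
Qed.

Lemma border_basis_border_ideal : border_basis B F0 J.
Proof.
split=> //; last exact: border_quotient_basis.
by exists (fun m => phi 'X_[m]); split=> // m /border_deg /phi_spec [].
Qed.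

(** A functional killing W extends to all polynomials by composition with the normal form. The
    extension kills J, and it agrees with [M] up to degree s because p - phi(p) is in W. *)
Lemma full_restr_border_ideal :
  full_restr s (full_perp J) =
  [set M : dual R n s | forall p : bpoly n R s, W (val p) -> M p = 0].
Proof.
apply/seteqP; split=> [M [L LJ ML] p Wp|M M0].
  by rewrite ML; apply/LJ/border_ideal_deg_le => //; exact: valP.
pose nf p : bpoly n R s := BPoly (mono_span_deg (normal_form_span p)).
pose L (p : {mpoly R[n]}) : R^o := M (nf p).
have L_lin : linear L.
  move=> a p q; rewrite /L -linearP; congr (M _); apply: val_inj.
  exact: normal_form_linear.
pose LL : {linear {mpoly R[n]} -> R^o} :=
  HB.pack L (GRing.isLinear.Build _ _ _ _ _ L_lin).
exists LL => [p /border_ideal_normal_form nf0|p].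
  rewrite /LL /= /L; have -> : nf p = 0 by exact: val_inj.
  exact: linear0.
rewrite /LL /= /L; apply/eqP; rewrite -subr_eq0 -linearB; apply/eqP/M0.
rewrite /= normal_form_phi; last exact: valP.
by case: (phi_spec (valP p)).
Qed.

End BorderBasis.

(** * Standard monomials *)

Section StandardMonomials.
Import Order.TTheory.
Variables (R : realType) (n s : nat) (W : set {mpoly R[n]}).
Hypothesis subW : is_submodule W.
Hypothesis W_deg : W `<=` deg_le s.
Hypothesis W_prev :
  forall p, mpoly_deg_le s p -> exists2 q, mpoly_deg_le s.-1 q & W (p - q).
Hypothesis W_prolong : forall p, mpoly_deg_le s p -> lspan (prolong W) p -> W p.
Hypothesis s_gt0 : (0 < s)%N.

(** The default [mlead 0] is the monomial 1, which [w != 0] keeps from always being leading. *)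
Definition leading_monomials : set 'X_{1..n} :=
  [set m | exists w, [/\ W w, w != 0 & mlead w = m]].

Definition standard_monomials : set 'X_{1..n} :=
  [set m | (mdeg m <= s)%N /\ ~ leading_monomials m].

Let subs := mpoly_deg_le_submodule R n s.

Lemma mono_span_msupp (B : set 'X_{1..n}) (u : {mpoly R[n]}) m :
  mono_span B u -> m \in msupp u -> B m.
Proof.
pose T : set {mpoly R[n]} := [set u | forall m, m \in msupp u -> B m].
suff TE : mono_span B `<=` T by move=> /TE; apply.
apply: lspan_min => [|_ [b Bb <-] k].
  split=> [k|a v w Tv Tw k]; first by rewrite msupp0.
  rewrite mcoeff_msupp mcoeffD mcoeffZ.
  have [/Tv //|/memN_msupp_eq0 ->] := boolP (k \in msupp v).
  have [/Tw //|/memN_msupp_eq0 ->] := boolP (k \in msupp w).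
  by rewrite mulr0 addr0 eqxx.
by rewrite msuppX inE => /eqP ->.
Qed.

Lemma mlead_deg_le (p : {mpoly R[n]}) : mpoly_deg_le s p -> (mdeg (mlead p) <= s)%N.
Proof.
have [->|p0] := eqVneq p 0; first by rewrite mlead0 mdeg0.
by rewrite /mpoly_deg_le -mlead_deg.
Qed.

(** Reduction: the leading term of p is cancelled by an element of W or by a standard monomial. A
    nonzero element of the intersection would have a leading monomial both standard and leading in
    W. *)
Lemma standard_direct_sum : direct_sum (deg_le s) (mono_span standard_monomials) W.
Proof.
have spanS : mono_span standard_monomials `<=` (deg_le s : set {mpoly R[n]}).
  apply: lspan_min => // _ [b [bs _] <-].
  by rewrite /= /mpoly_deg_le msizeX.
split; last first.
  apply/seteqP; split=> [u [Bu Wu]|_ ->]; last first.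
    by split; [exact: submodule0 (lspan_submodule _) | exact: submodule0 subW].
  apply/eqP/negPn/negP => u0.
  by have [_ []] := mono_span_msupp Bu (mlead_supp u0); exists u.
apply/seteqP; split=> [p|_ [u [w [/spanS us /W_deg ws ->]]]]; last first.
  exact: submoduleD subs _ _ us ws.
rewrite /mkset; elim/mleadrect: p => p IH ps.
have [->|p0] := eqVneq p 0.
  exists 0, 0; rewrite addr0; split=> //; last exact: submodule0 subW.
  exact: submodule0 (lspan_submodule _).
have [r [rs r0 rp rBW]] : exists r, [/\ mpoly_deg_le s r, r != 0, mlead r = mlead p
    & mono_span standard_monomials r \/ W r].
  have [[w [Ww w0 wp]]|Bp] := pselect (leading_monomials (mlead p)).
    by exists w; split; [exact: W_deg | | | right].
  have BX : mono_span standard_monomials ('X_[mlead p] : {mpoly R[n]}).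
    by apply: sub_lspan; exists (mlead p) => //; split=> //; exact: mlead_deg_le.
  exists 'X_[mlead p]; split; [exact: spanS | | exact: mleadXm | by left].
  by rewrite -msize_poly_eq0 msizeX.
pose c := mleadc p / mleadc r; pose q := p - c *: r.
have pE : p = c *: r + q by rewrite addrC subrK.
have qs : mpoly_deg_le s q by apply: (submoduleB subs) => //; exact: submoduleZ subs _ _ rs.
have [u [w [Bu Ww qE]]] : exists u w,
    [/\ mono_span standard_monomials u, W w & q = u + w].
  (* [mlead 0] is 1, not below [mlead p] when p is constant, so q = 0 is treated apart. *)
  have [->|q0] := eqVneq q 0.
    exists 0, 0; rewrite addr0; split=> //; last exact: submodule0 subW.
    exact: submodule0 (lspan_submodule _).
  apply: IH => //; rewrite lt_neqAle; apply/andP; split.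
    apply: contraNneq q0 => lq; rewrite -mleadc_eq0 lq mcoeffB mcoeffZ -rp.
    by rewrite /c -rp divfK ?subrr // mleadc_eq0.
  apply: le_trans (mleadB_le _ _) _; rewrite leUx lexx /=.
  by apply: le_trans (mleadZ_le _ _) _; rewrite rp.
case: rBW => [Br|Wr].
  exists (c *: r + u), w; split=> //; last by rewrite -addrA -qE.
  exact: (lspan_submodule _).2.
exists u, (c *: r + w); split=> //; first exact: subW.2.
by rewrite addrCA -qE.
Qed.

(** If m had degree s, some m - q in W with deg q < s would have m as leading monomial, the order
    being graded. *)
Lemma standard_mdeg m : standard_monomials m -> (mdeg m < s)%N.
Proof.
move=> [ms notlead]; rewrite ltn_neqAle ms andbT; apply/eqP => mE.
have [|q qs Wq] := W_prev (p := 'X_[m]); first by rewrite /mpoly_deg_le msizeX mE.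
have wlead : mlead ('X_[m] - q) = m.
  have [->|q0] := eqVneq q 0; first by rewrite subr0 mleadXm.
  rewrite mleadDl mleadXm // mleadN; apply: lt_mdeg_ltmc.
  by rewrite mlead_deg // mE; move: qs; rewrite /mpoly_deg_le prednK.
apply: notlead; exists ('X_[m] - q); split=> //.
(* If m - q were 0, m would be the default leading monomial 1, forcing s = 0. *)
apply/eqP => w0; move: wlead mE; rewrite w0 mlead0 => <-; rewrite mdeg0 => s0.
by move: s_gt0; rewrite -s0.
Qed.

(** The witness is multiplied by one variable at a time; degrees stay at most s, so [W_prolong]
    keeps it in W. *)
Lemma leading_monomials_mul k m : leading_monomials m ->
  (mdeg (k + m)%MM <= s)%N -> leading_monomials (k + m)%MM.
Proof.
move=> lm; elim/monomial_ind: k => [|i k IH]; first by rewrite add0m.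
rewrite -addmA mdegD mdeg1 => kms.
have [w [Ww w0 wE]] := IH (ltnW kms).
have X0 : 'X_i != 0 :> {mpoly R[n]} by rewrite -msize_poly_eq0 msizeX.
exists ('X_i * w); split; rewrite ?mulf_neq0 //; last first.
  by rewrite mleadM // mleadXm wE.
apply: W_prolong; last by apply: sub_lspan; right; exists i, w.
by rewrite /mpoly_deg_le -mlead_deg ?mulf_neq0 // mleadM // mleadXm wE mdegD mdeg1.
Qed.

Lemma standard_division_closed : division_closed standard_monomials.
Proof.
move=> m m' [ms notlead] m'm; have mE := submK m'm.
split; last by move=> /(leading_monomials_mul (k := (m - m')%MM)); rewrite mE => /(_ ms).
by apply: leq_trans ms; rewrite -mE mdegD leq_addl.
Qed.

Lemma sum_mnm1E (w : seq 'I_n) i : (\sum_(j <- w) U_(j))%MM i = count_mem i w.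
Proof.
rewrite mnm_sumE -sum1_count [RHS]big_mkcond /=; apply: eq_bigr => j _.
by rewrite mnm1E; case: eqP.
Qed.

(** Every prefix of a word for m is a divisor of m. *)
Lemma division_closed_connected (B : set 'X_{1..n}) :
  division_closed B -> connected_to_1 B.
Proof.
move=> divB m Bm; exists (monomial_word m); split=> [|h _].
  by apply/mnmP => i; rewrite sum_mnm1E count_monomial_word.
apply: divB Bm _; apply/mnm_lepP => i; rewrite sum_mnm1E -[leqRHS]count_monomial_word.
by rewrite -{2}(cat_take_drop h (monomial_word m)) count_cat leq_addr.
Qed.

End StandardMonomials.

(** * The dimension of Span(B) and the final argument *)

Section Dimension.
Variables (R : realType) (n : nat).

(** If Span(B) is nonzero, B has an element, and the empty prefix of its word is 1. *)
Lemma mono_span_dim_unit (B : set 'X_{1..n}) s (U : {vspace bpoly n R s}) :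
    connected_to_1 B -> (forall p : bpoly n R s, p \in U <-> mono_span B (val p)) ->
  \dim U <> 0%N -> B 0%MM.
Proof.
move=> connB UE /eqP; have [//|B0] := pselect (B 0%MM).
rewrite dimv_eq0 -subv0; case/negP; apply/subvP => p /UE Bp.
rewrite memv0; apply/eqP/val_inj => /=.
pose T : set {mpoly R[n]} := [set 0].
apply: (@lspan_min _ _ _ T) Bp => [|p0 [b Bb _]].
  by split=> // a u v -> ->; rewrite /T /= scaler0 addr0.
by have [w [_ /(_ 0%N isT)]] := connB _ Bb; rewrite take0 big_nil.
Qed.

End Dimension.

Lemma card_eq_ord (T : Type) (A : set T) d : (A #= `I_d)%card ->
  exists2 v : 'I_d -> T, injective v & forall i, A (v i).
Proof.
rewrite card_eq_sym => /card_bijP [f /bij_inj f_inj].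
pose o (i : 'I_d) : `I_d := exist _ (val i) (mem_set (ltn_ord i)).
exists (fun i => \val (f (o i))) => [i j /val_inj /f_inj [] /val_inj //|i].
exact: set_mem (valP (f (o i))).
Qed.

Theorem theorem4 (R : realType) (n m : nat) (h : 'I_m -> {mpoly R[n]})
    (s t : nat) (G : set {mpoly R[n]}) :
  let I : set {mpoly R[n]} := ideal_gen (range h) in
  let D := (\max_(j < m) (msize (h j)).-1)%N in
  let Rx_s : set {mpoly R[n]} := [set p | mpoly_deg_le s p] in
  let dG := setdim (restr s (perp t G)) in
  (1 <= s)%N -> (s <= t)%N ->
  (forall p, G p -> mpoly_deg_le t p) ->
  (forall j, G (h j)) ->
  (G `<=` I \/ G `<=` real_radical I) ->
  (dG = 0%N ->
     (G `<=` I -> VC I = set0) /\ (G `<=` real_radical I -> VR I = set0))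
  /\
  (dG <> 0%N ->
   (D <= s)%N ->
   dG = setdim (restr s.-1 (perp t G)) ->
   dG = setdim (restr s (perp t.+1 (prolong G))) ->
   let decomposes (B : set 'X_{1..n}) :=
     direct_sum Rx_s (mono_span B : set {mpoly R[n]}) (Rx_s `&` lspan G) in
   (exists B : set 'X_{1..n},
      [/\ forall b, B b -> (mdeg b <= s.-1)%N,
          division_closed B, connected_to_1 B & decomposes B])
   /\
   (forall (B : set 'X_{1..n}) (phi : {mpoly R[n]} -> {mpoly R[n]}),
      (forall b, B b -> (mdeg b <= s.-1)%N) ->
      connected_to_1 B ->
      decomposes B ->
      projection_onto_along (mono_span B) (Rx_s `&` lspan G) phi ->
      let F0 : set {mpoly R[n]} :=
        [set 'X_[b] - phi 'X_[b] | b in border B] in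
      let J := ideal_gen F0 in
      [/\ quotient_basis B J,
          border_basis B F0 J,
          (G `<=` I -> J = I)
        & (G `<=` real_radical I ->
           [/\ VR I = [set v : 'rV[R]_n | VC J (map_mx (real_complex R) v)],
               J `&` Rx_s = lspan G `&` Rx_s,
               full_restr s (full_perp J) = restr s (perp t G)
             & (VR I #= `I_dG)%card -> J = real_radical I])])).
Proof.
move=> I D Rx_s dG s_gt0 st Gt Gh _.
have idealI : is_ideal I := ideal_gen_ideal _.
have G_vanish : G `<=` real_radical I -> forall v : 'rV[R]_n, VR I v ->
    lspan G `<=` [set p | p.@[v ord0] = 0].
  move=> Grad v Iv; apply: (lspan_ideal (meval_ideal v)) => p /Grad.
  exact: real_radical_vanish.
split=> [dG0|dG_neq0 Ds dG_prev dG_prolong decomposes].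
  (* Dimension zero puts all of R[x]_s, in particular 1, in Span(G). *)
  have G1 : lspan G 1.
    by apply: (restr_perp_dim0 st Gt dG0); rewrite /mpoly_deg_le msize1.
  split=> [GI|Grad]; apply/seteqP; split=> // v Iv.
    have := Iv 1 (lspan_ideal idealI GI G1).
    by rewrite cevalE rmorph1 => /eqP; rewrite oner_eq0.
  have := G_vanish Grad v Iv 1 G1.
  by rewrite /= meval1 => /eqP; rewrite oner_eq0.
pose W := Rx_s `&` lspan G.
have subW : is_submodule W.
  by apply: is_submoduleI; [exact: mpoly_deg_le_submodule | exact: lspan_submodule].
(* The second rank condition: prolonging G adds nothing to its span in degree at most s. *)
have W_prolong p : mpoly_deg_le s p -> lspan (prolong W) p -> W p.
  move=> ps Wp; split=> //.
  apply: (restr_perp_dim_mono st (leqW st) Gt (prolong_deg_le Gt) _ dG_prolong) => //.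
    by move=> q; left.
  apply: prolong_lspan; apply: lspan_mono Wp => q [[_ Gq]|[i [r [[_ Gr] ->]]]]; first by left.
  by right; exists i, r.
have mdegP (B : set 'X_{1..n}) :
    (forall b, B b -> (mdeg b <= s.-1)%N) <-> (forall b, B b -> (mdeg b < s)%N).
  have E b : (mdeg b <= s.-1)%N = (mdeg b < s)%N by rewrite -ltnS prednK.
  by split=> Bs b /Bs; rewrite E.
split.
  (* The first rank condition: R[x]_s = R[x]_(s-1) + W. *)
  have W_prev p : mpoly_deg_le s p -> exists2 q, mpoly_deg_le s.-1 q & W (p - q).
    move=> ps; have [q qs Gq] := restr_perp_dim_prev (leq_pred s) st Gt dG_prev ps.
    exists q => //; split=> //.
    apply: submoduleB (mpoly_deg_le_submodule R n s) _ _ ps _.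
    exact: mpoly_deg_le_trans (leq_pred s) qs.
  have divB := @standard_division_closed _ _ s W W_prolong.
  exists (standard_monomials s W); split=> //.
  - by apply/mdegP => b; exact: standard_mdeg.
  - exact: division_closed_connected.
  - by apply: standard_direct_sum => // w [].
move=> B phi /mdegP B_deg connB dS phiP F0 J.
have [U UE dU] := restr_perp_dim_complement st Gt (lspan_submodule _) dS.
have B_unit : B 0%MM by apply: (mono_span_dim_unit connB UE); rewrite dU.
have JW := border_ideal_deg_le B_deg B_unit subW dS phiP W_prolong.
(* The generators of [J] lie in Span(G). This is applied to [I], to the ideal of a real point and to
   the real radical. *)
have JG p : J p -> forall T, is_ideal T -> lspan G `<=` T -> T p.
  move=> Jp T idealT GT; apply: (ideal_gen_min idealT _ Jp) => q.
  by move=> /(border_sub B_deg dS phiP) [_ /GT].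
have IJ : I `<=` J.
  apply: ideal_gen_min; first exact: ideal_gen_ideal.
  (* Since s >= D, the generators h_j already lie in W. *)
  move=> _ [j _ <-]; have hs : mpoly_deg_le s (h j).
    rewrite /mpoly_deg_le -add1n -leq_subLR subn1.
    exact: leq_trans (leq_bigmax j) Ds.
  by apply/(JW _ hs); split=> //; exact: sub_lspan.
split.
- exact: (border_quotient_basis B_deg B_unit subW dS phiP W_prolong).
- exact: (border_basis_border_ideal B_deg B_unit subW dS phiP W_prolong).
- move=> GI; apply/seteqP; split=> // p Jp.
  by apply: (JG p Jp) => //; exact: lspan_ideal.
move=> Grad.
have J_vanish v : VR I v -> forall p, J p -> p.@[v ord0] = 0.
  move=> Iv p Jp; apply: (JG p Jp _ (meval_ideal v)); exact: G_vanish.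
split.
- apply/seteqP; split=> v.
    by move=> /J_vanish Jv; apply/(VRP J v).
  by move=> Jv; apply/VRP => p /IJ; move: p; apply/VRP.
- by apply/seteqP; split=> p [Jp ps]; split=> //; [case/JW: Jp | apply/JW].
- rewrite (restr_perpE st Gt) (full_restr_border_ideal B_deg B_unit subW dS phiP W_prolong).
  apply/seteqP; split=> M M0 p; last by move=> [_ /M0].
  by move=> Gp; apply: M0; split=> //; exact: valP.
move=> /card_eq_ord [v v_inj Iv]; have rad_ideal := real_radical_ideal idealI.
apply/seteqP; split=> p; first move=> Jp.
  by apply: (JG p Jp) => //; exact: lspan_ideal.
(* The normal form of p has the same values as p at the points of V_R(I), hence vanishes there;
   lying in Span(B), of dimension the number of points, it is 0, so p is in [J]. *)
move=> rad_p; have p_v i : p.@[v i ord0] = 0 := real_radical_vanish (Iv i) rad_p.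
have nf_v q i : (normal_form phi q).@[v i ord0] = q.@[v i ord0].
  have := J_vanish _ (Iv i) _ (normal_form_mod B_deg B_unit subW dS phiP W_prolong q).
  by rewrite mevalB => /eqP; rewrite subr_eq0 => /eqP.
have nf_B q := normal_form_span B_deg B_unit dS phiP q.
pose nf q : bpoly n R s := BPoly (mono_span_deg subW dS (nf_B q)).
apply/(border_ideal_normal_form B_deg B_unit subW dS phiP W_prolong).
rewrite -[LHS]/(val (nf p)) (vanishing_in_subspace v_inj dU _ (q := nf p)) //.
- by move=> q; exists (nf q); [apply/UE; exact: nf_B | exact: nf_v].
- by apply/UE; exact: nf_B.
- by move=> i; rewrite /= nf_v.
Qed.
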